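(* For every $m \in \mathbb{N}$ and every $x \in \mathbb{N}$, the list $\mathrm{lgen}_m(x)$ is sorted in non-increasing order and all its elements are $\le m$.
   Context: Lists of natural numbers: $[\,]$ is the empty list, $h :: t$ the list with head $h$ and tail $t$. For $m \in \mathbb{N}$, $\mathrm{next}_m$ is defined recursively by: $\mathrm{next}_m([\,]) = [0]$; $\mathrm{next}_m(h :: t) = (h+1) :: t$ if $h < m$; and if $h \ge m$: $\mathrm{next}_m(h :: t) = [\,]$ when $\mathrm{next}_m(t) = [\,]$, and $\mathrm{next}_m(h :: t) = x :: x :: t'$ when $\mathrm{next}_m(t) = x :: t'$. The function $\mathrm{lgen}_m : \mathbb{N} \to$ lists is defined by $\mathrm{lgen}_m(0) = [\,]$ and $\mathrm{lgen}_m(x+1) = \mathrm{next}_m(\mathrm{lgen}_m(x))$. *)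

(* Defs.v *)
From mathcomp Require Import all_boot.
Set Implicit Arguments.
Unset Strict Implicit.
Unset Printing Implicit Defensive.

Fixpoint lnext (m : nat) (s : seq nat) : seq nat :=
  match s with
  | [::] => [:: 0]
  | h :: t =>
      if h < m then h.+1 :: t
      else match lnext m t with
           | [::] => [::]
           | x :: t' => [:: x, x & t']
           end
  end.

Fixpoint lgen (m x : nat) : seq nat :=
  match x with
  | 0 => [::]
  | x'.+1 => lnext m (lgen m x')
  end.

(* Main.v *)
Require Import Defs.
From mathcomp Require Import all_boot.
Set Implicit Arguments.
Unset Strict Implicit.
Unset Printing Implicit Defensive.

(** Order and bound hold for [[::]] and are invariants of [lnext m], by induction on the list
    ([lnext_sorted_bounded]). Incrementing a head below [m] keeps it at most [m] and still at least
    the next entry; the other case is a carry into the tail. *)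

Lemma lnext_sorted_bounded (m : nat) (s : seq nat) :
  sorted geq s -> all (geq m) s ->
  sorted geq (lnext m s) /\ all (geq m) (lnext m s).
Proof.
elim: s => [|h t IH] //= ht_sorted /andP[_ t_le].
case: ltnP => [h_lt|_] /=.
  split; last by rewrite h_lt.
  case: t ht_sorted {IH t_le} => [|k t] //= /andP[k_le ->].
  by rewrite (leq_trans k_le) /=.
(* Carry: [h] is discarded, and the result is [lnext m t] with its head, if any, repeated; the order
   is non-strict, so the repetition is harmless. *)
have [] := IH (path_sorted ht_sorted) t_le.
case: (lnext m t) => [|x t'] //= xt_sorted /andP[x_le t'_le].
by rewrite leqnn xt_sorted x_le.
Qed.

Theorem theorem6 (m x : nat) :
  sorted geq (lgen m x) /\ (forall y : nat, y \in lgen m x -> y <= m).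
Proof.
suff [lgen_sorted /allP lgen_le] : sorted geq (lgen m x) /\ all (geq m) (lgen m x).
  by split.
elim: x => [|x [lgen_sorted lgen_le]] //=.
exact: lnext_sorted_bounded.
Qed.
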